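(* Let $d\ge 2$ and let $C(L)$ be the number of self-avoiding walks in $\mathbb{Z}^d$ that cross the $L\times L\times\cdots\times L$ hypercube from one corner vertex to the diagonally opposite corner vertex, and let $\log\lambda_d=\lim_{L\to\infty}L^{-d}\log C(L)$. Then, as $L\to\infty$, $$C(L)\le\lambda_d^{\,L^d+dL^{d-1}+o(L^{d-1})} .$$
   Context: For a positive integer $L$, the hypercube of side $L$ is the subgraph of the lattice $\mathbb{Z}^d$ (nearest-neighbour edges) induced by the vertex set $\{0,1,\dots,L\}^d$. A self-avoiding walk is a nearest-neighbour lattice path that visits no vertex more than once. $C(L)$ counts the self-avoiding walks that stay in the hypercube of side $L$, start at a fixed corner vertex (say $(0,\dots,0)$) and end at the diagonally opposite corner vertex (say $(L,\dots,L)$). The limit $\lim_{L\to\infty}L^{-d}\log C(L)$ exists and is finite; $\lambda_d$ is defined by setting this limit equal to $\log\lambda_d$. The displayed inequality means that there is a function $r(L)$ with $r(L)/L^{d-1}\to 0$ as $L\to\infty$ such that $\log C(L)\le (L^d+dL^{d-1}+r(L))\log\lambda_d$ for all $L$. *)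

(* Defs.v *)
From HB Require Import structures.
From mathcomp Require Import all_boot all_order all_algebra.
From mathcomp Require Import all_classical all_reals all_analysis.

Set Implicit Arguments.
Unset Strict Implicit.
Unset Printing Implicit Defensive.

Import Order.TTheory GRing.Theory Num.Theory.
Import numFieldNormedType.Exports.

Local Open Scope classical_set_scope.
Local Open Scope ring_scope.

(* The vertex set {0, 1, ..., L}^d. *)
Definition cube (d L : nat) : finType := {ffun 'I_d -> 'I_L.+1}.

(* Nearest-neighbour edges of Z^d: l^1-distance 1 between integer vectors. *)
Definition cube_adj (d L : nat) : rel (cube d L) :=
  fun x y => (\sum_(i < d) `|(x i : nat)%:Z - (y i : nat)%:Z|%N == 1)%N.

Definition corner0 (d L : nat) : cube d L := [ffun=> ord0].

Definition cornerL (d L : nat) : cube d L := [ffun=> ord_max].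

(* A walk is encoded by the sequence of vertices visited after [corner0]. *)
Definition crossing_saw (d L : nat) (w : seq (cube d L)) : bool :=
  [&& path (@cube_adj d L) (corner0 d L) w,
      last (corner0 d L) w == cornerL d L
    & uniq (corner0 d L :: w)].

(* A self-avoiding walk with n steps visits n + 1 distinct vertices, so only
   the lengths n < #|cube d L| can occur. *)
Definition num_saw (d L : nat) : nat :=
  (\sum_(n < #|cube d L|)
    #|[set w : n.-tuple (cube d L) | crossing_saw w]%SET|)%N.

(* [lim] is total: this is the intended limit because the sequence converges.
   The term at L = 0 is irrelevant. *)
Definition log_lambda (R : realType) (d : nat) : R :=
  lim ((fun L : nat => ln (num_saw d L)%:R / L%:R ^+ d : R) @ \oo).

Definition lambda (R : realType) (d : nat) : R := expR (log_lambda R d).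

(* Main.v *)
(**
Stack an odd number M of translates of a box in one coordinate direction, and
reflect every second one in the other coordinates: corner-to-corner crossings of
the pieces then concatenate to a crossing of the stack.  Doing this in each
direction in turn gives C(L) ^ (M ^ d) <= C(N) whenever M (L + 1) <= N + 1.  Hence
log C(L) / (L + 1) ^ d, which is bounded, converges to its supremum, which is
log lambda_d, and so C(L) <= lambda_d ^ ((L + 1) ^ d).
*)
Require Import Defs.
From HB Require Import structures.
From mathcomp Require Import all_boot all_order all_algebra.
From mathcomp Require Import all_classical all_reals all_analysis.
From mathcomp Require Import zify lra ring.

Set Implicit Arguments.
Unset Strict Implicit.
Unset Printing Implicit Defensive.

Import Order.TTheory GRing.Theory Num.Theory.
Import numFieldNormedType.Exports.

Local Open Scope classical_set_scope.
Local Open Scope ring_scope.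

(** * Families of self-avoiding walks: gluing and transport *)

Definition saw (T : eqType) (e : rel T) (A : pred T) (u v : T) (p : seq T) :=
  [&& path e u p, last u p == v, uniq (u :: p) & all A (u :: p)].

(** A duplicate-free list certifies a lower bound on the number of walks, so that [T] may be
    infinite. *)
Definition many_saws (T : eqType) (e : rel T) (A : pred T) (u v : T) (m : nat) :=
  exists s : seq (seq T), [/\ uniq s, size s = m & all (saw e A u v) s].

Lemma saw_cat (T : eqType) (e : rel T) (A B : pred T) (u v u' v' : T)
    (p q : seq T) :
  (forall x, A x -> ~~ B x) -> e v u' ->
  saw e A u v p -> saw e B u' v' q -> saw e (predU A B) u v' (p ++ u' :: q).
Proof.
move=> AB evu /and4P[pp /eqP lp up ap] /and4P[pq /eqP lq uq aq].
have allp : all (predU A B) (u :: p) by apply: sub_all ap => x /= ->.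
have allq : all (predU A B) (u' :: q).
  by apply: sub_all aq => x /= ->; rewrite orbT.
apply/and4P; split.
- by rewrite cat_path pp lp /= evu.
- by rewrite last_cat /= lq.
- rewrite -cat_cons cat_uniq up uq andbT; apply/hasPn => x /(allP aq) Bx.
  by apply/negP => /(allP ap) /AB; rewrite Bx.
- by rewrite -cat_cons all_cat allp.
Qed.

Lemma many_saws_glue (T : eqType) (e : rel T) (A B : pred T) (u v u' v' : T)
    (m n : nat) :
  (forall x, A x -> ~~ B x) -> e v u' ->
  many_saws e A u v m -> many_saws e B u' v' n ->
  many_saws e (predU A B) u v' (m * n).
Proof.
move=> AB evu [s [us ss sA]] [t [ut st tB]].
exists [seq p ++ u' :: q | p <- s, q <- t]; split.
(* The first factor is recovered from the concatenation as its part inside A. *)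
- apply: allpairs_uniq => //= -[p1 q1] [p2 q2] /=.
  move=> /allpairsP[[p q] /= [ps qt [-> ->]]].
  move=> /allpairsP[[p' q'] /= [p's q't [-> ->]]] eqpq.
  have AF r : r \in s -> forall w, w \in t -> [seq x <- r ++ u' :: w | A x] = r.
    move=> /(allP sA) /and4P[_ _ _ /= /andP[_ rA]] w /(allP tB).
    move=> /and4P[_ _ _ wB]; rewrite filter_cat (all_filterP rA).
    rewrite [X in _ ++ X](_ : _ = [::]) ?cats0 //.
    apply/eqP; rewrite -[_ == _]negbK -has_filter; apply/hasPn => x.
    by move/(allP wB); apply: contraL => /AB.
  have epp : p = p' by rewrite -(AF p ps q qt) -(AF p' p's q' q't) eqpq.
  by move: eqpq; rewrite epp => /eqP; rewrite eqseq_cat // eqxx /= => /eqP[->].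
- by rewrite size_allpairs ss st.
- apply/allP => _ /allpairsP[[p q] /= [ps qt ->]].
  by apply: saw_cat AB evu (allP sA _ ps) (allP tB _ qt).
Qed.

(** The hypotheses on [g] are local to [A] because reflections written with truncated subtraction,
    and [inord], are faithful only inside a box. *)
Lemma many_saws_map (T T' : eqType) (g : T -> T') (e : rel T) (e' : rel T')
    (A : pred T) (B : pred T') (u v : T) (m : nat) :
  (forall x y, A x -> A y -> g x = g y -> x = y) ->
  (forall x y, A x -> A y -> e x y -> e' (g x) (g y)) ->
  (forall x, A x -> B (g x)) ->
  many_saws e A u v m -> many_saws e' B (g u) (g v) m.
Proof.
move=> ginj ge gAB [s [us ss sA]].
exists [seq map g p | p <- s]; split; last 1 first.
- apply/allP => _ /mapP[p ps ->]; have /and4P[pp /eqP lp up ap] := allP sA _ ps.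
  apply/and4P; split.
  + elim: p (u) pp ap {lp up ps} => //= y p IHp x /andP[exy pyp].
    by move=> /and3P[Ax Ay Ap]; rewrite ge //= IHp //= Ay.
  + by rewrite last_map lp.
  + rewrite -map_cons map_inj_in_uniq // => x y /(allP ap) Ax /(allP ap) Ay.
    exact: ginj.
  + rewrite -map_cons all_map; apply/allP => x /(allP ap); exact: gAB.
- rewrite map_inj_in_uniq // => p q ps qs.
  have /and4P[_ _ _ /andP[_ ap]] := allP sA _ ps.
  have /and4P[_ _ _ /andP[_ aq]] := allP sA _ qs.
  elim: p q ap aq {ps qs} => [|x p IHp] [|y q] //= /andP[Ax Ap] /andP[Ay Aq].
  by move=> [/ginj -> // /IHp ->].
- by rewrite size_map.
Qed.

Lemma many_saws_sub (T : eqType) (e : rel T) (A B : pred T) (u v : T) (m : nat) :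
  (forall x, A x -> B x) -> many_saws e A u v m -> many_saws e B u v m.
Proof. by move=> AB; apply: (@many_saws_map _ _ id). Qed.

Lemma many_saws1 (T : eqType) (e : rel T) (u : T) : many_saws e (pred1 u) u u 1.
Proof. by exists [:: [::]]; split=> //=; rewrite /saw /= !eqxx. Qed.

(** * Stacking boxes in the nonnegative orthant *)

Section Boxes.
Variable d : nat.
Notation point := {ffun 'I_d -> nat}.

Lemma pointP (x y : point) : (forall i, x i = y i) -> x = y.
Proof. by move/ffunP. Qed.

(** The adjacency of [cube_adj], on one vertex type common to boxes of all shapes, so that their
    walks can be concatenated. *)
Definition adj : rel point :=
  fun x y => (\sum_(i < d) `|(x i)%:Z - (y i)%:Z|%N == 1)%N.

Definition box (n : point) : pred point := fun x => [forall i, (x i <= n i)%N].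

Definition origin : point := [ffun=> 0%N].

Definition upd (k : 'I_d) (h : nat) (x : point) : point :=
  [ffun i => if i == k then h else x i].

Definition slab (k : 'I_d) (n : point) (lo hi : nat) : pred point :=
  fun x => [forall i, if i == k then (lo <= x i <= hi)%N else (x i <= n i)%N].

Definition crossings (n : point) (m : nat) := many_saws adj (box n) origin n m.

Lemma adj_upd (k : 'I_d) (h : nat) (x : point) : adj (upd k h x) (upd k h.+1 x).
Proof.
rewrite /adj (bigD1 k) //= big1 => [|i /negPf ik]; rewrite !ffunE ?ik ?eqxx; lia.
Qed.

Lemma box_upd (k : 'I_d) (n : point) (h : nat) : box (upd k h n) =1 slab k n 0 h.
Proof. by move=> x; apply: eq_forallb => i; rewrite ffunE; case: eqP. Qed.

Lemma slab_translate (k : 'I_d) (n : point) (lo b m : nat) :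
  crossings (upd k b n) m ->
  many_saws adj (slab k n lo (lo + b)) (upd k lo origin) (upd k (lo + b) n) m.
Proof.
pose g (x : point) : point := upd k (lo + x k) x.
have -> : upd k lo origin = g origin.
  by apply/ffunP => i; rewrite !ffunE addn0.
have -> : upd k (lo + b) n = g (upd k b n).
  by apply/ffunP => i; rewrite !ffunE eqxx; case: eqP.
have ginj : injective g.
  move=> x y /ffunP gxy; apply/ffunP => i; move: (gxy i); rewrite !ffunE.
  by case: eqP => // -> /addnI.
have gadj x y : adj x y -> adj (g x) (g y).
  rewrite /adj; congr (_ == _); apply: eq_bigr => i _; rewrite !ffunE.
  by case: eqP => // ->; lia.
have gbox x : box (upd k b n) x -> slab k n lo (lo + b) (g x).
  rewrite box_upd => /forallP /= bx; apply/forallP => i; have := bx i.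
  by rewrite ffunE; case: eqP => // ->; lia.
by apply: many_saws_map => [x y _ _ /ginj|x y _ _|]; auto.
Qed.

(** Reflecting every coordinate but [k] makes the walk start next to the end [upd k (lo - 1) n] of
    an unreflected piece below, and climb back to the side of the origin. *)
Lemma slab_reflect (k : 'I_d) (n : point) (lo b m : nat) :
  crossings (upd k b n) m ->
  many_saws adj (slab k n lo (lo + b)) (upd k lo n) (upd k (lo + b) origin) m.
Proof.
pose g (x : point) : point :=
  [ffun i => if i == k then lo + x i else n i - x i]%N.
have -> : upd k lo n = g origin.
  by apply/ffunP => i; rewrite !ffunE addn0 subn0.
have -> : upd k (lo + b) origin = g (upd k b n).
  by apply/ffunP => i; rewrite !ffunE; case: eqP => // _; lia.
have boxP x i : box (upd k b n) x -> (x i <= if i == k then b else n i)%N.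
  by move=> /forallP /(_ i); rewrite ffunE.
have ginj x y : box (upd k b n) x -> box (upd k b n) y -> g x = g y -> x = y.
  move=> bx bY gxy; apply: pointP => i.
  move: (congr1 (fun z : point => z i) gxy); rewrite !ffunE.
  by move: (boxP x i bx) (boxP y i bY); case: eqP => // _; lia.
have gadj x y : box (upd k b n) x -> box (upd k b n) y ->
    adj x y -> adj (g x) (g y).
  move=> bx bY; rewrite /adj; congr (_ == _); apply: eq_bigr => i _.
  rewrite !ffunE.
  by move: (boxP x i bx) (boxP y i bY); case: eqP => // _; lia.
have gbox x : box (upd k b n) x -> slab k n lo (lo + b) (g x).
  move=> bx; apply/forallP => i; move: (boxP x i bx).
  by rewrite ffunE; case: eqP => // _; lia.
exact: many_saws_map ginj gadj gbox.
Qed.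

(** On layers 0 to a lies the given crossing, on the next b + 1 a reflected one, on the last b + 1 a
    translated one. Adding pieces in such pairs ends at the far corner again, whence the odd
    multiples below. *)
Lemma crossings_stack3 (k : 'I_d) (n : point) (a b m p : nat) :
  crossings (upd k a n) m -> crossings (upd k b n) p ->
  crossings (upd k (a + b.+1.*2) n) (m * p * p).
Proof.
move=> /(@slab_translate _ _ 0) ca cb.
have cb1 := slab_reflect a.+1 cb.
have cb2 := slab_translate (a.+1 + b).+1 cb.
rewrite add0n in ca.
have c12 := many_saws_glue _ (adj_upd k a n) ca cb1.
have {c12} := many_saws_glue _ (adj_upd k (a.+1 + b) origin) (c12 _) cb2.
have -> : upd k 0 origin = origin by apply/ffunP => i; rewrite !ffunE; case: eqP.
have -> : ((a.+1 + b).+1 + b = a + b.+1.*2)%N by lia.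
move=> c; apply: many_saws_sub (c _ _) => x.
- rewrite box_upd /= => /orP[/orP[]|] /forallP /= sx; apply/forallP => i /=;
  by have := sx i; case: eqP => // _; lia.
- move=> sx; apply/negP => /forallP sx'; have := sx' k; rewrite eqxx.
  by case/orP: sx => /forallP /(_ k); rewrite eqxx; lia.
- move=> /forallP sx; apply/negP => /forallP sx'.
  by have := sx k; have := sx' k; rewrite eqxx; lia.
Qed.

(** Each walk is prolonged along a straight edge in direction [k], one vertex at a time; this
    absorbs the rounding when the copies do not fill the box. *)
Lemma crossings_extend (k : 'I_d) (n : point) (a b m : nat) :
  (a <= b)%N -> crossings (upd k a n) m -> crossings (upd k b n) m.
Proof.
move=> /subnK <-; elim: (b - a)%N => // j IHj /IHj c.
have := many_saws_glue _ (adj_upd k (j + a) n) c (many_saws1 adj _).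
rewrite muln1 => {}c; apply: many_saws_sub (c _) => x; rewrite /= box_upd.
- rewrite box_upd => /orP[/forallP /= sx|/eqP ->]; apply/forallP => i /=.
    by have := sx i; case: eqP => // _; lia.
  by rewrite !ffunE; case: eqP => // _; lia.
- move=> /forallP /(_ k); rewrite eqxx => xk; apply/negP => /eqP xE.
  by move: xk; rewrite xE ffunE eqxx; lia.
Qed.

Lemma crossings_stack (k : 'I_d) (n : point) (a b m j : nat) :
  (j.*2.+1 * a.+1 <= b.+1)%N ->
  crossings (upd k a n) m -> crossings (upd k b n) (m ^ j.*2.+1).
Proof.
(* Side a means a + 1 layers of vertices, so 2j + 1 copies have side (2j + 1)(a + 1) - 1. *)
move=> jab c; apply: (@crossings_extend _ _ (j.*2.+1 * a.+1).-1); first by lia.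
elim: j {jab} => [|j IHj]; first by rewrite mul1n expn1.
have := crossings_stack3 IHj c.
by congr crossings; [congr upd; lia | rewrite doubleS !expnS; lia].
Qed.

Lemma crossings_cube (L N m j : nat) :
  (j.*2.+1 * L.+1 <= N.+1)%N ->
  crossings ([ffun=> L] : point) m ->
  crossings ([ffun=> N] : point) (m ^ (j.*2.+1 ^ d)).
Proof.
(* In [side t] the first t directions are already enlarged to N; each further direction raises the
   count to the power 2j + 1. *)
move=> jLN c; pose side t : point :=
  [ffun i : 'I_d => if (i < t)%N then N else L].
have -> : [ffun=> N] = side d by apply/ffunP => i; rewrite !ffunE ltn_ord.
suff sideP t : (t <= d)%N -> crossings (side t) (m ^ (j.*2.+1 ^ t)).
  exact: sideP.
elim: t => [_|t IHt td].
  by rewrite expn0 expn1 (_ : side 0 = [ffun=> L]).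
have := IHt (ltnW td); set k := Ordinal td.
have -> : side t = upd k L (side t).
  apply/ffunP => i; rewrite !ffunE; case: eqP => // ->; by rewrite ltnn.
move=> /(crossings_stack jLN); rewrite -expnM -expnSr.
rewrite (_ : upd k N _ = side t.+1) //.
apply/ffunP => i; rewrite !ffunE -val_eqE /=.
by rewrite ltnS; case: ltngtP.
Qed.

End Boxes.

(** * Counting the crossings of a cube *)

Section NumSaw.
Variables d L : nat.

Let sawT := {n : 'I_#|cube d L| & n.-tuple (cube d L)}.

(** Pairing each length with its tuples gathers the sum in [num_saw] into a single list of plain
    sequences. *)
Definition saw_seq : seq (seq (cube d L)) :=
  map (fun z : sawT => tval (tagged z))
    (enum [pred z : sawT | crossing_saw (tagged z)]).

Lemma size_saw_seq : size saw_seq = num_saw d L.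
Proof.
rewrite size_map -cardE -sum1_card /num_saw.
under [RHS]eq_bigr do rewrite -sum1_card.
rewrite (sig_big_dep _ _ (fun (n : 'I_#|cube d L|) (w : n.-tuple (cube d L)) => 1%N)) /=.
by apply: eq_bigl => z; rewrite !inE.
Qed.

Lemma saw_seq_uniq : uniq saw_seq.
Proof.
rewrite map_inj_uniq ?enum_uniq // => -[n w] [n' w'] /= eww.
have nn : n = n' by apply/val_inj; rewrite /= -(size_tuple w) -(size_tuple w') eww.
by case: _ / nn w' eww => w' /val_inj ->.
Qed.

Lemma mem_saw_seq w : (w \in saw_seq) = crossing_saw w.
Proof.
apply/mapP/idP => [[z + ->]|cw]; first by rewrite mem_enum.
have sw : (size w < #|cube d L|)%N.
  case/and3P: cw => _ _ /card_uniqP /= <-; exact: max_card.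
by exists (Tagged (fun n : 'I_#|cube d L| => n.-tuple (cube d L))
  (in_tuple w : (Ordinal sw).-tuple (cube d L))); rewrite ?mem_enum.
Qed.

Lemma crossing_sawE :
  @crossing_saw d L =1
  saw (@cube_adj d L) predT (corner0 d L) (cornerL d L).
Proof. by move=> w; rewrite /saw all_predT andbT. Qed.

Lemma num_saw_max m :
  many_saws (@cube_adj d L) predT (corner0 d L) (cornerL d L) m ->
  (m <= num_saw d L)%N.
Proof.
case=> s [us <- /allP sA]; rewrite -size_saw_seq; apply: uniq_leq_size => // w.
by move/sA; rewrite mem_saw_seq crossing_sawE.
Qed.

Lemma num_saw_many :
  many_saws (@cube_adj d L) predT (corner0 d L) (cornerL d L) (num_saw d L).
Proof.
exists saw_seq; split; [exact: saw_seq_uniq|exact: size_saw_seq|].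
by apply/allP => w; rewrite mem_saw_seq crossing_sawE.
Qed.

Lemma num_saw_crossings :
  crossings ([ffun=> L] : {ffun 'I_d -> nat}) (num_saw d L).
Proof.
pose g (x : cube d L) : {ffun 'I_d -> nat} := [ffun i => x i : nat].
have := @many_saws_map _ _ g _ (@adj d) predT (box [ffun=> L]) _ _ _ _ _ _ num_saw_many.
have -> : g (corner0 d L) = origin d by apply/ffunP => i; rewrite !ffunE.
have -> : g (cornerL d L) = [ffun=> L] by apply/ffunP => i; rewrite !ffunE.
apply=> [x y _ _ /ffunP gxy|x y _ _|x _].
- by apply/ffunP => i; apply/val_inj; have := gxy i; rewrite !ffunE.
- by rewrite /adj /cube_adj; under [X in _ -> X == _]eq_bigr do rewrite !ffunE.
- by apply/forallP => i; rewrite !ffunE -ltnS.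
Qed.

Lemma crossings_num_saw m :
  crossings ([ffun=> L] : {ffun 'I_d -> nat}) m ->
  (m <= num_saw d L)%N.
Proof.
move=> c; apply: num_saw_max.
pose g (x : {ffun 'I_d -> nat}) : cube d L := [ffun i => inord (x i)].
have := @many_saws_map _ _ g _ (@cube_adj d L) _ predT _ _ _ _ _ _ c.
have -> : g (origin d) = corner0 d L.
  by apply/ffunP => i; apply/val_inj; rewrite !ffunE /= inordK.
have -> : g [ffun=> L] = cornerL d L.
  by apply/ffunP => i; apply/val_inj; rewrite !ffunE /= inordK.
(* Outside the box [inord] returns a default value; inside, it preserves the coordinates. *)
have bP (x : {ffun 'I_d -> nat}) i : box [ffun=> L] x -> g x i = x i :> nat.
  by move/forallP => /(_ i); rewrite !ffunE -ltnS => ?; rewrite inordK.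
apply=> [x y bx bY /ffunP gxy|x y bx bY|x _] //.
- by apply/ffunP => i; have := congr1 val (gxy i); rewrite /= !bP.
- by rewrite /adj /cube_adj; under [X in _ -> X == _]eq_bigr do rewrite !bP //.
Qed.

(** The step y - x, whose coordinates lie in {-1, 0, 1} for neighbours, shifted by 1; adding before
    subtracting avoids truncation. *)
Definition step_code (x y : cube d L) : {ffun 'I_d -> 'I_3} :=
  [ffun i => inord (y i + 1 - x i)].

Lemma step_code_inj (x y z : cube d L) :
  cube_adj x y -> cube_adj x z -> step_code x y = step_code x z -> y = z.
Proof.
have near (a b : cube d L) i : cube_adj a b -> (`|(a i : nat)%:Z - (b i : nat)%:Z| <= 1)%N.
  by move=> /eqP <-; rewrite (bigD1 i) //= leq_addr.
have coord (a b c : nat) : (`|a%:Z - b%:Z| <= 1)%N -> (`|a%:Z - c%:Z| <= 1)%N ->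
    inord (b + 1 - a) = inord (c + 1 - a) :> 'I_3 -> b = c.
  by move=> ab ac /(congr1 val); rewrite /= !inordK; lia.
move=> xy xz /ffunP exyz; apply/ffunP => i; apply/val_inj => /=.
have := exyz i; rewrite !ffunE; apply: coord; exact: near.
Qed.

(** A walk is determined by its step codes. With V vertices there are V lengths and at most (3^d)^V
    code words for each, and V <= (3^d)^V. This crude bound keeps the growth rate finite. *)
Lemma num_saw_le : (num_saw d L <= (3 ^ d) ^ (L.+1 ^ d).*2)%N.
Proof.
have cV : #|cube d L| = (L.+1 ^ d)%N by rewrite card_ffun !card_ord.
have cK : #|{: {ffun 'I_d -> 'I_3}}| = (3 ^ d)%N by rewrite card_ffun !card_ord.
rewrite -cV; set V := #|cube d L|; have K0 : (0 < 3 ^ d)%N by rewrite expn_gt0.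
apply: (@leq_trans (V * (3 ^ d) ^ V)).
  rewrite /num_saw -[V in (V * _)%N](card_ord V) -sum_nat_const.
  apply: leq_sum => n _.
  have -> : ((3 ^ d) ^ V = (3 ^ d) ^ (V - n) * (3 ^ d) ^ n)%N.
    by rewrite -expnD subnK // ltnW.
  rewrite -[X in (X <= _)%N]mul1n leq_mul ?expn_gt0 ?K0 //.
  have -> : ((3 ^ d) ^ n = #|{: n.-tuple {ffun 'I_d -> 'I_3}}|)%N.
    by rewrite card_tuple cK.
  rewrite -(card_in_imset (f := fun w : n.-tuple (cube d L) =>
     pairmap_tuple step_code (corner0 d L) w)) ?max_card // => w w'.
  rewrite !inE => /and3P[pw _ _] /and3P[pw' _ _] /(congr1 val) /= eww.
  apply/val_inj => /=; move: pw pw' eww.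
  move: (tval w) (tval w') (corner0 d L).
  elim=> [|y p IHp] [|z q] //= x /andP[xy yp] /andP[xz zq] [].
  by move/step_code_inj => /(_ xy xz) yz; rewrite -yz in zq *; move/IHp => ->.
rewrite -addnn expnD leq_mul // {}/V {}cV {cK K0}.
(* For d = 0 the base [3 ^ d] is 1, so the strict bound [ltn_expl] fails, but both sides equal 1. *)
case: d => [|d']; first by rewrite !expn0 expn1.
by rewrite ltnW // ltn_expl // (@ltn_exp2l 3 0).
Qed.

End NumSaw.

(** The one-vertex cube has a crossing, and stacking with j = 0 merely extends it by straight edges.
    Positivity makes the logarithms meaningful. *)
Lemma num_saw_gt0 d L : (0 < num_saw d L)%N.
Proof.
have c0 : crossings ([ffun=> 0%N] : {ffun 'I_d -> nat}) 1.
  apply: many_saws_sub (many_saws1 (@adj d) (origin d)) => x /= /eqP ->.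
  by apply/forallP => i; rewrite !ffunE.
by have := crossings_num_saw (@crossings_cube _ 0 L _ 0 isT c0); rewrite exp1n.
Qed.

Lemma num_saw_expn d L N j :
  (j.*2.+1 * L.+1 <= N.+1)%N ->
  (num_saw d L ^ (j.*2.+1 ^ d) <= num_saw d N)%N.
Proof.
by move=> jLN; apply/crossings_num_saw/(crossings_cube jLN)/num_saw_crossings.
Qed.

(** With h = 1/L this controls (L + 1)^d beyond its two leading terms. *)
Lemma bernoulli_remainder (R : realFieldType) (d : nat) :
  exists K : R, forall h : R, 0 <= h <= 1 ->
    0 <= (1 + h) ^+ d - 1 - d%:R * h <= K * h ^+ 2.
Proof.
elim: d => [|d [K IHd]]; first by exists 0 => h _; rewrite expr0; lra.
(* The new remainder is (1 + h) g + d h^2, and 1 + h <= 2. *)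
exists (2 * K + d%:R) => h h01; have /andP[g0 gK] := IHd h h01.
have d0 : 0 <= d%:R :> R by [].
set g := (1 + h) ^+ d - 1 - d%:R * h in g0 gK.
have -> : (1 + h) ^+ d.+1 - 1 - d.+1%:R * h = (1 + h) * g + d%:R * h ^+ 2.
  by rewrite /g exprS -addn1 natrD; ring.
by apply/andP; split; nra.
Qed.

(** * The growth rate as a supremum *)

Section Rate.
Variables (R : realType) (d : nat).

(** Dividing by the number of vertices, not by L^d, matches the stacking condition and makes the
    limit a supremum. *)
Definition saw_rate (L : nat) : R := ln (num_saw d L)%:R / L.+1%:R ^+ d.

Lemma ln_num_saw_ge0 (L : nat) : 0 <= ln (num_saw d L)%:R :> R.
Proof. by rewrite ln_ge0 // ler1n num_saw_gt0. Qed.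

Lemma saw_rate_ge0 (L : nat) : 0 <= saw_rate L.
Proof. by rewrite /saw_rate divr_ge0 ?ln_num_saw_ge0 ?exprn_ge0. Qed.

Lemma ln_num_saw (L : nat) : ln (num_saw d L)%:R = saw_rate L * L.+1%:R ^+ d.
Proof. by rewrite /saw_rate divfK // expf_neq0 // pnatr_eq0. Qed.

Lemma saw_rate_le (L : nat) : saw_rate L <= ln ((3 ^ d)%:R : R) *+ 2.
Proof.
rewrite /saw_rate ler_pdivrMr ?exprn_gt0 //.
have : ln (num_saw d L)%:R <= ln ((3 ^ d) ^ (L.+1 ^ d).*2)%:R :> R.
  rewrite ler_ln ?posrE ?ltr0n ?num_saw_gt0 ?expn_gt0 //.
  by rewrite ler_nat num_saw_le.
move=> /le_trans; apply; rewrite (natrX _ (3 ^ d)) lnXn ?ltr0n ?expn_gt0 //.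
by rewrite -muln2 mulnC mulrnA -[leLHS]mulr_natr (natrX _ L.+1).
Qed.

Lemma has_sup_saw_rate : has_sup (range saw_rate).
Proof.
split; first by exists (saw_rate 0), 0%N.
by exists (ln (3 ^ d)%:R *+ 2) => _ [L _ <-]; exact: saw_rate_le.
Qed.

Lemma saw_rate_le_sup (L : nat) : saw_rate L <= sup (range saw_rate).
Proof. by apply: sup_upper_bound; [exact: has_sup_saw_rate | exists L]. Qed.

Lemma saw_rate_ge (L N : nat) : (2 * L.+1 <= N.+1)%N ->
  saw_rate L * (1 - (2 * L.+1)%:R / N.+1%:R) ^+ d <= saw_rate N.
Proof.
(* M is the largest odd number with M (L + 1) <= N + 1, so M (L + 1) falls short of N + 1 by at most
   2 (L + 1). *)
move=> LN; pose j := ((N.+1 %/ L.+1).-1)./2; set M := j.*2.+1.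
have M_le : (M * L.+1 <= N.+1)%N.
  have := leq_divM N.+1 L.+1; have q2 : (2 <= N.+1 %/ L.+1)%N by rewrite leq_divRL.
  by apply: leq_trans; rewrite leq_mul2r /M /j; lia.
have M_ge : (N.+1 <= M * L.+1 + 2 * L.+1)%N.
  rewrite -mulnDl {1}(divn_eq N.+1 L.+1).
  apply: (@leq_trans ((N.+1 %/ L.+1).+1 * L.+1)).
    by rewrite mulSn addnC leq_add2r ltnW // ltn_mod.
  by rewrite leq_mul2r /M /j; lia.
have N0 : 0 < N.+1%:R :> R by [].
rewrite {2}/saw_rate ler_pdivlMr ?exprn_gt0 // -mulrA -exprMn.
apply: (@le_trans _ _ (saw_rate L * (M * L.+1)%:R ^+ d)).
  rewrite ler_wpM2l ?saw_rate_ge0 // lerXn2r ?nnegrE //.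
    rewrite mulrBl mul1r divfK ?gt_eqF // subr_ge0 ler_nat //.
  rewrite mulrBl mul1r divfK ?gt_eqF // lerBlDr -natrD ler_nat //.
have : ln (num_saw d L ^ (M ^ d))%:R <= ln (num_saw d N)%:R :> R.
  rewrite ler_ln ?posrE ?ltr0n ?num_saw_gt0 ?expn_gt0 ?num_saw_gt0 //.
  by rewrite ler_nat num_saw_expn.
rewrite (natrX _ (num_saw d L)) lnXn ?ltr0n ?num_saw_gt0 //.
rewrite ln_num_saw -[leLHS]mulr_natr (natrX _ M) natrM.
by rewrite exprMn -mulrA [X in _ * X]mulrC.
Qed.

Lemma cvg_saw_rate : saw_rate @ \oo --> sup (range saw_rate).
Proof.
apply/cvgrPdist_lt => e e0.
(* As in Fekete's lemma, one L with rate within e of the supremum forces all large N to have such a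
   rate. *)
have [_ [L _ <-] Le] := sup_adherent e0 has_sup_saw_rate.
have cvL : (fun N => saw_rate L * (1 - (2 * L.+1)%:R / N.+1%:R) ^+ d) @ \oo
    --> saw_rate L * (1 - (2 * L.+1)%:R * 0) ^+ d.
  apply: cvgMr; apply: (@cvg_comp _ _ _ _ (fun x : R => x ^+ d));
    last exact: exprn_continuous.
  apply: cvgB; first exact: cvg_cst.
  apply: cvgMr; exact: cvg_harmonic.
rewrite mulr0 subr0 expr1n mulr1 in cvL.
near=> N.
have LN : (2 * L.+1 <= N.+1)%N by apply: leqW; near: N; exact: nbhs_infty_ge.
rewrite ger0_norm ?subr_ge0 ?saw_rate_le_sup // ltrBlDr -ltrBlDl.
apply: lt_le_trans (saw_rate_ge LN); near: N; exact: cvgr_gt cvL _ Le.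
Unshelve. all: by end_near.
Qed.

Lemma cvg_invn : (fun n : nat => n%:R^-1 : R) @ \oo --> (0 : R).
Proof. by rewrite -cvg_shiftS; exact: cvg_harmonic. Qed.

(** Passing from (L + 1)^d to L^d costs the factor (1 + 1/L)^d, which tends to 1. The proof
    establishes convergence, so the [lim] is a genuine limit. *)
Lemma log_lambdaE : log_lambda R d = sup (range saw_rate).
Proof.
apply: cvg_lim; first exact: Rhausdorff.
have : (fun L : nat => saw_rate L * (1 + L%:R^-1) ^+ d) @ \oo
    --> sup (range saw_rate) * (1 + 0) ^+ d.
  apply: cvgM; first exact: cvg_saw_rate.
  apply: (@cvg_comp _ _ _ _ (fun x : R => x ^+ d));
    last exact: exprn_continuous.
  by apply: cvgD; [exact: cvg_cst | exact: cvg_invn].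
rewrite addr0 expr1n mulr1; apply: cvg_trans; apply: near_eq_cvg.
near=> L.
have L0 : L%:R != 0 :> R.
  by rewrite pnatr_eq0 -lt0n; near: L; exact: nbhs_infty_gt.
rewrite ln_num_saw -mulrA -expr_div_n; congr (_ * _ ^+ _).
by rewrite -natr1 mulrDl divff // mul1r.
Unshelve. all: by end_near.
Qed.

Lemma num_saw_le_lambda (L : nat) :
  (num_saw d L)%:R <= lambda R d `^ (L.+1%:R ^+ d).
Proof.
rewrite /lambda /powR gt_eqF ?expR_gt0 // expRK log_lambdaE.
rewrite -[leLHS]lnK ?posrE ?ltr0n ?num_saw_gt0 // ler_expR ln_num_saw mulrC.
by rewrite ler_wpM2l ?exprn_ge0 // saw_rate_le_sup.
Qed.

End Rate.

Theorem theorem5 (R : realType) (d : nat) (hd : (2 <= d)%N) :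
  exists r : nat -> R,
    ((fun L : nat => r L / L%:R ^+ (d - 1)) @ \oo --> (0 : R)) /\
    (forall L : nat, (0 < L)%N ->
      (num_saw d L)%:R <=
        lambda R d `^ (L%:R ^+ d + d%:R * L%:R ^+ (d - 1) + r L)).
Proof.
(* This choice turns the exponent into exactly (L + 1)^d. *)
exists (fun L => L.+1%:R ^+ d - L%:R ^+ d - d%:R * L%:R ^+ (d - 1)).
split; last first.
  move=> L _; rewrite [X in _ `^ X](_ : _ = L.+1%:R ^+ d); last by ring.
  exact: num_saw_le_lambda.
have [K remP] := bernoulli_remainder R d.
have cvK : (fun L : nat => K * L%:R^-1) @ \oo --> (0 : R).
  by rewrite -[X in _ --> X](mulr0 K); apply: cvgMr; exact: cvg_invn.
apply: squeeze_cvgr (cvg_cst 0) cvK.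
near=> L.
have L1 : (0 < L)%N by near: L; exact: nbhs_infty_gt.
have L0 : 0 < L%:R :> R by rewrite ltr0n.
have h01 : 0 <= (L%:R^-1 : R) <= 1 by rewrite invr_ge0 ltW //= invf_le1 // ler1n.
(* Factoring out L^d leaves L times the Bernoulli remainder at 1/L, hence a value between 0 and
   K/L. *)
have -> : (L.+1%:R ^+ d - L%:R ^+ d - d%:R * L%:R ^+ (d - 1)) / L%:R ^+ (d - 1) =
    L%:R * ((1 + L%:R^-1) ^+ d - 1 - d%:R * L%:R^-1) :> R.
  have -> : L.+1%:R = L%:R * (1 + L%:R^-1) :> R.
    by rewrite mulrDr mulr1 divff ?gt_eqF // natr1.
  rewrite exprMn; have -> : (L%:R : R) ^+ d = L%:R * L%:R ^+ (d - 1).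
    by rewrite -exprS subn1 prednK // ltnW.
  move: ((1 + L%:R^-1) ^+ d) => Q; field.
  by rewrite expf_neq0 gt_eqF.
have /andP[rem0 remK] := remP _ h01.
rewrite mulr_ge0 ?(ltW L0) //=.
have -> : K * L%:R^-1 = L%:R * (K * L%:R^-1 ^+ 2) by field; rewrite gt_eqF.
by rewrite ler_pM2l.
Unshelve. all: by end_near.
Qed.
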